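(* Let $H_n$ be the height of a tree chosen uniformly at random from $\mathcal Y_n$. There exists a continuous decreasing function $I(\xi)$ with $I(\xi)>0$ for $0<\xi\le1$ such that, for any fixed $\delta>0$, there is a constant $K$ (depending on $\delta$) with \[ \mathbb{P}(H_n\ge \xi n)\le K\,n^{3/2}e^{-nI(\xi)}\qquad\text{for all } \delta<\xi<1-\delta . \]
   Context: A tree in $\mathcal Y$ is a rooted, non-plane (children unordered), unlabelled binary tree: every node has either $0$ or $2$ children, trees being counted up to isomorphism; the one-node tree is included. The size of a tree is its number of external nodes, and $\mathcal Y_n$ is the set of trees of size $n$. The height of a tree is the maximum number of edges on a path from the root to an external node.
   Formalization: ''Decreasing'' is corrected to ''increasing'' (strictly, on (0,1]): a decreasing I would force a rate of at least I(1/2)>0 for all small ξ, but grafting trees on a spine of ξn edges shows the rate of P(H_n ≥ ξn) tends to 0 as ξ→0. *)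

(* Defs.v *)
From HB Require Import structures.
From mathcomp Require Import all_boot all_order all_algebra.
From mathcomp Require Import finmap.
From mathcomp Require Import all_classical all_reals all_analysis.

Set Implicit Arguments.
Unset Strict Implicit.
Unset Printing Implicit Defensive.

Import Order.TTheory GRing.Theory Num.Theory.
Local Open Scope classical_set_scope.
Local Open Scope ring_scope.

Inductive ptree : Type := Leaf | Node of ptree & ptree.

Fixpoint ptree_encode (t : ptree) : GenTree.tree nat :=
  match t with
  | Leaf => GenTree.Leaf 0%N
  | Node l r => GenTree.Node 0 [:: ptree_encode l; ptree_encode r]
  end.

Fixpoint ptree_decode (t : GenTree.tree nat) : option ptree :=
  match t with
  | GenTree.Leaf _ => Some Leaf
  | GenTree.Node _ [:: l; r] =>
      match ptree_decode l, ptree_decode r with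
      | Some l', Some r' => Some (Node l' r')
      | _, _ => None
      end
  | _ => None
  end.

Lemma ptree_encodeK : pcancel ptree_encode ptree_decode.
Proof. by elim=> [|l IHl r IHr] //=; rewrite IHl IHr. Qed.

HB.instance Definition _ := Countable.copy ptree (pcan_type ptree_encodeK).

Fixpoint psize (t : ptree) : nat :=
  match t with
  | Leaf => 1
  | Node l r => psize l + psize r
  end.

Fixpoint pheight (t : ptree) : nat :=
  match t with
  | Leaf => 0
  | Node l r => (maxn (pheight l) (pheight r)).+1
  end.

(* Isomorphism of rooted trees, the order of the children being irrelevant. *)
Fixpoint iso (t u : ptree) : bool :=
  match t, u with
  | Leaf, Leaf => true
  | Node a b, Node c d => (iso a c && iso b d) || (iso a d && iso b c)
  | _, _ => false
  end.

Lemma iso_refl : reflexive iso.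
Proof. by elim=> [|l IHl r IHr] //=; rewrite IHl IHr. Qed.

Lemma iso_sym : symmetric iso.
Proof.
elim=> [|a IHa b IHb] [|c d] //=.
by rewrite !IHa !IHb; congr (_ || _); rewrite andbC.
Qed.

Lemma iso_trans : transitive iso.
Proof.
move=> u; elim: u => [|a IHa b IHb] [|c d] [|e f] //=.
case/orP=> /andP[H1 H2] /orP[] /andP[H3 H4]; apply/orP.
- by left; rewrite (IHa _ _ H1 H3) (IHb _ _ H2 H4).
- by right; rewrite (IHa _ _ H1 H3) (IHb _ _ H2 H4).
- by right; rewrite (IHb _ _ H1 H4) (IHa _ _ H2 H3).
- by left; rewrite (IHb _ _ H1 H4) (IHa _ _ H2 H3).
Qed.

Canonical iso_equiv := EquivRel iso iso_refl iso_sym iso_trans.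

Definition ytree := {eq_quot iso_equiv}%qT.

HB.instance Definition _ := Choice.on ytree.
HB.instance Definition _ := EqQuotient.on ytree.

Definition ysize (t : ytree) : nat := psize (repr t).
Definition yheight (t : ytree) : nat := pheight (repr t).

Lemma iso_psize (t u : ptree) : iso t u -> psize t = psize u.
Proof.
elim: t u => [|a IHa b IHb] [|c d] //=.
by case/orP=> /andP[/IHa-> /IHb->] //; rewrite addnC.
Qed.

Lemma iso_pheight (t u : ptree) : iso t u -> pheight t = pheight u.
Proof.
elim: t u => [|a IHa b IHb] [|c d] //=.
by case/orP=> /andP[/IHa-> /IHb->] //; rewrite maxnC.
Qed.

Lemma ysize_pi (t : ptree) : ysize (\pi_ytree t)%qT = psize t.
Proof. by apply: iso_psize; apply/eqmodP; rewrite reprK. Qed.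

Lemma yheight_pi (t : ptree) : yheight (\pi_ytree t)%qT = pheight t.
Proof. by apply: iso_pheight; apply/eqmodP; rewrite reprK. Qed.

Definition Y (n : nat) : set ytree := [set t | ysize t = n].

Lemma finite_Y (n : nat) : finite_set (Y n).
Proof.
have psize_gt0 t : (0 < psize t)%N.
  by elim: t => //= l Hl r _; rewrite addn_gt0 Hl.
have [s sP] : exists s : seq ptree, forall t, (psize t <= n)%N -> t \in s.
  elim: n => [|n [s IH]].
    by exists [::] => t; rewrite leqNgt psize_gt0.
  exists (Leaf :: [seq Node l r | l <- s, r <- s]) => -[|l r] //= Hlr.
  rewrite inE; apply/orP; right; apply: allpairs_f; apply: IH.
    by rewrite -ltnS (leq_trans _ Hlr) // -addn1 leq_add2l.
  by rewrite -ltnS (leq_trans _ Hlr) // -add1n leq_add2r.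
apply: (@sub_finite_set _ _ [set` [seq (\pi_ytree t)%qT | t <- s]]) => //.
move=> t /= tn; apply/mapP; exists (repr t); last by rewrite reprK.
by apply: sP; rewrite -tn.
Qed.

(* [fset_set A] is the finite set with the elements of [A] when [A] is finite
   and is empty otherwise; the definition is meant for finite nonempty [A]. *)
Definition uniform_prob (R : realType) (T : choiceType) (A E : set T) : R :=
  (#|` fset_set (A `&` E)|)%:R / (#|` fset_set A|)%:R.

Definition prob_height_ge (R : realType) (n : nat) (x : R) : R :=
  uniform_prob R (Y n) [set t | x <= (yheight t)%:R].

(* Main.v *)
(* Let Y(z) be the generating function of the trees by size. From
   Y(z) = z + (Y(z)^2 + Y(z^2)) / 2, i.e. (1 - Y(z))^2 = 1 - 2z - Y(z^2), one
   gets Y(z) <= 1 - sqrt(2 (r - z)) for z < r whenever Y converges at r.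
   Peeling off a longest path bounds the generating function of the trees of
   height at least h by Y(z)^(h+1), so the number of trees of size n and height
   at least xi n is at most z^(-n) (1 - sqrt(2 (r - z)))^(xi n). With r close to
   the radius of convergence and r - z of order xi^2 this beats, by a factor
   exponential in xi^2 n, the lower bound of order w^(-n) for the number of trees
   of size n; the latter holds for every w above the radius of convergence,
   because twice the number of trees of size n + m is at least the product of the
   numbers for n and m. To avoid power series, Y is replaced by the polynomials
   ygen h that enumerate the trees of height at most h; these are all bounded by
   1 as soon as they are uniformly bounded. *)
Require Import Defs.
From mathcomp Require Import all_boot all_order all_algebra.
From mathcomp Require Import finmap.
From mathcomp Require Import all_classical all_reals all_analysis.
From mathcomp Require Import ring lra zify.

Import Order.TTheory GRing.Theory Num.Theory.
Import numFieldNormedType.Exports.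
Local Open Scope classical_set_scope.
Local Open Scope ring_scope.

(** * Constructors on isomorphism classes of trees *)

Definition yleaf : ytree := (\pi_ytree Leaf)%qT.

Definition ynode (a b : ytree) : ytree :=
  (\pi_ytree (Node (repr a) (repr b)))%qT.

Lemma ysize_leaf : ysize yleaf = 1%N.
Proof. by rewrite /yleaf ysize_pi. Qed.

Lemma yheight_leaf : yheight yleaf = 0%N.
Proof. by rewrite /yleaf yheight_pi. Qed.

Lemma ysize_node (a b : ytree) : ysize (ynode a b) = (ysize a + ysize b)%N.
Proof. by rewrite /ynode ysize_pi. Qed.

Lemma yheight_node (a b : ytree) :
  yheight (ynode a b) = (maxn (yheight a) (yheight b)).+1.
Proof. by rewrite /ynode yheight_pi. Qed.

Lemma iso_repr (a b : ytree) : iso (repr a) (repr b) -> a = b.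
Proof.
by move=> ab; rewrite -(reprK a) -(reprK b); apply/(@eqmodP _ iso_equiv).
Qed.

Lemma repr_pi_iso (t : ptree) : iso (repr (\pi_ytree t)%qT) t.
Proof. by apply/(@eqmodP _ iso_equiv); rewrite reprK. Qed.

Lemma ynodeC (a b : ytree) : ynode a b = ynode b a.
Proof.
by apply/(@eqmodP _ iso_equiv) => /=; rewrite !iso_refl orbT.
Qed.

Lemma ynode_inj (a b c d : ytree) : ynode a b = ynode c d ->
  (a = c /\ b = d) \/ (a = d /\ b = c).
Proof.
move=> /(@eqmodP _ iso_equiv) /= /orP[] /andP[/iso_repr -> /iso_repr ->].
- by left.
- by right.
Qed.

Lemma ytree_cases (t : ytree) : t = yleaf \/ exists a b, t = ynode a b.
Proof.
rewrite -(reprK t); case: (repr t) => [|l r]; first by left.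
right; exists (\pi_ytree l)%qT, (\pi_ytree r)%qT.
apply/(@eqmodP _ iso_equiv) => /=; apply/orP; left.
by apply/andP; split; rewrite iso_sym; exact: repr_pi_iso.
Qed.

Lemma yheight_lt_size (t : ytree) : (yheight t < ysize t)%N.
Proof.
rewrite /yheight /ysize; elim: (repr t) => //= l IHl r IHr; lia.
Qed.

(** * Duplicate-free enumeration by height *)

Definition ycode (t : ytree) : nat := choice.pickle (repr t).

Lemma ycode_inj : injective ycode.
Proof.
move=> a b /(pcan_inj (@choice.pickleK ptree)) ab.
by rewrite -(reprK a) ab reprK.
Qed.

(* Listing the child of larger height first makes the height of a node that
   of its first child plus one. *)
Definition yle (a b : ytree) : bool :=
  (yheight b < yheight a)%N ||
  ((yheight a == yheight b) && (ycode a <= ycode b)%N).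

Lemma yle_total (a b : ytree) : yle a b || yle b a.
Proof. rewrite /yle; lia. Qed.

Lemma yle_anti (a b : ytree) : yle a b && yle b a = (a == b).
Proof.
apply/idP/eqP => [ab|->]; last by rewrite /yle eqxx leqnn orbT.
apply: ycode_inj; move: ab; rewrite /yle; lia.
Qed.

Lemma yle_height (a b : ytree) :
  yle a b -> yheight (ynode a b) = (yheight a).+1.
Proof. rewrite /yle yheight_node; lia. Qed.

(** Since [yle] is total and antisymmetric, keeping only the pairs it relates picks one ordering of
    each unordered pair of children. *)
Fixpoint ytrees (h : nat) : seq ytree :=
  if h is h'.+1 then
    yleaf :: [seq ynode p.1 p.2 |
               p <- [seq (a, b) | a <- ytrees h', b <- ytrees h'] & yle p.1 p.2]
  else [:: yleaf].

Lemma mem_ytrees (h : nat) (t : ytree) : (t \in ytrees h) = (yheight t <= h)%N.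
Proof.
elim: h t => [|h IH] t.
  rewrite inE; case: (ytree_cases t) => [->|[a [b ->]]].
    by rewrite eqxx yheight_leaf.
  rewrite yheight_node; apply/eqP => /(congr1 yheight).
  by rewrite yheight_node yheight_leaf.
rewrite /= inE; apply/idP/idP.
  case/orP => [/eqP ->|/mapP[[a b]]]; first by rewrite yheight_leaf.
  rewrite mem_filter /= => /andP[_ /allpairsP[[c d] /= [cL dL [-> ->]]]] ->.
  by rewrite yheight_node ltnS geq_max -!IH cL dL.
case: (ytree_cases t) => [->|[a [b ->]]]; first by rewrite eqxx.
rewrite yheight_node ltnS geq_max -!IH => /andP[aL bL].
apply/orP; right; case/orP: (yle_total a b) => ab.
  apply/mapP; exists (a, b) => //.
  by rewrite mem_filter ab; apply: allpairs_f.
apply/mapP; exists (b, a); last exact: ynodeC.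
by rewrite mem_filter ab; apply: allpairs_f.
Qed.

Lemma ytrees_uniq (h : nat) : uniq (ytrees h).
Proof.
elim: h => //= h IH; apply/andP; split.
  apply/mapP => -[[a b] _ /(congr1 yheight)].
  by rewrite yheight_node yheight_leaf.
rewrite map_inj_in_uniq; last first.
  move=> [a b] [c d]; rewrite !mem_filter /= => /andP[ab _] /andP[cd _].
  case/ynode_inj => -[? ?]; subst => //.
  by have /eqP -> : c == d by rewrite -yle_anti cd ab.
by apply: filter_uniq; apply: allpairs_uniq => // -[? ?] [? ?].
Qed.

Section Sums.
Context {R : realFieldType}.
Implicit Type F : ytree -> R.

Lemma sum_ytreesS (h : nat) F :
  \sum_(t <- ytrees h.+1) F t =
  F yleaf +
  \sum_(a <- ytrees h) \sum_(b <- ytrees h | yle a b) F (ynode a b).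
Proof.
rewrite /= big_cons big_map big_filter big_mkcond big_allpairs /=.
by congr (_ + _); apply: eq_bigr => a _; rewrite -big_mkcond.
Qed.

(* Each unordered pair of distinct subtrees is counted twice among ordered
   pairs, and each pair of equal ones once. *)
Lemma double_sum_ytreesS (h : nat) F :
  2 * \sum_(t <- ytrees h.+1) F t =
  2 * F yleaf +
  \sum_(a <- ytrees h) \sum_(b <- ytrees h) F (ynode a b) +
  \sum_(a <- ytrees h) F (ynode a a).
Proof.
rewrite sum_ytreesS mulrDr -addrA; congr (_ + _).
set L := ytrees h.
pose S := \sum_(a <- L) \sum_(b <- L | yle a b) F (ynode a b).
have S' : S = \sum_(a <- L) \sum_(b <- L | yle b a) F (ynode a b).
  rewrite /S; under eq_bigr do rewrite big_mkcond.
  rewrite exchange_big /=; apply: eq_bigr => a _; rewrite [RHS]big_mkcond.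
  by apply: eq_bigr => b _; rewrite ynodeC.
rewrite -/S mulr_natl mulr2n {2}S' /S -big_split -big_split /=.
rewrite big_seq [RHS]big_seq; apply: eq_bigr => a aL.
(* The diagonal consists of the pairs related both ways; what remains is inclusion-exclusion for
   each pair. *)
have -> : F (ynode a a) = \sum_(b <- L | yle a b && yle b a) F (ynode a b).
  under eq_bigl do rewrite yle_anti.
  rewrite big_mkcond (bigD1_seq a) ?ytrees_uniq //= eqxx big1 ?addr0 // => b.
  by rewrite eq_sym => /negPf ->.
rewrite big_mkcond [X in _ + X]big_mkcond [X in _ = _ + X]big_mkcond.
rewrite -!big_split.
apply: eq_bigr => b _ /=; have := yle_total a b.
by case: (yle a b); case: (yle b a) => //= _; rewrite ?addr0 ?add0r.
Qed.

End Sums.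

(** * Generating polynomials of bounded height *)

Section GeneratingPolynomial.
Context {R : realFieldType}.
Implicit Types z w : R.

Definition ygen (h : nat) (z : R) : R := \sum_(t <- ytrees h) z ^+ ysize t.

Lemma ygen0 z : ygen 0 z = z.
Proof. by rewrite /ygen big_seq1 ysize_leaf expr1. Qed.

Lemma ygenS (h : nat) z :
  2 * ygen h.+1 z = 2 * z + ygen h z ^+ 2 + ygen h (z ^+ 2).
Proof.
rewrite /ygen double_sum_ytreesS ysize_leaf expr1; congr (_ + _ + _).
  rewrite expr2 big_distrl /=; apply: eq_bigr => a _; rewrite big_distrr /=.
  by apply: eq_bigr => b _; rewrite ysize_node exprD.
by apply: eq_bigr => a _; rewrite ysize_node addnn -mul2n exprM.
Qed.

Lemma ygen_ge0 (h : nat) z : 0 <= z -> 0 <= ygen h z.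
Proof. by move=> z0; apply: sumr_ge0 => t _; rewrite exprn_ge0. Qed.

Lemma ygen_le (h : nat) z w : 0 <= z -> z <= w -> ygen h z <= ygen h w.
Proof.
move=> z0 zw; apply: ler_sum => t _.
by rewrite lerXn2r ?nnegrE // (le_trans z0).
Qed.

Lemma ygen_leS (h : nat) z : 0 <= z -> ygen h z <= ygen h.+1 z.
Proof.
elim: h z => [|h IH] z z0.
  have := ygenS 0 z.
  have := sqr_ge0 z.
  rewrite !ygen0; lra.
have := ygenS h z; have := ygenS h.+1 z.
have := IH _ (sqr_ge0 z).
have : ygen h z ^+ 2 <= ygen h.+1 z ^+ 2.
  by rewrite lerXn2r ?nnegrE ?ygen_ge0 ?IH.
lra.
Qed.

Lemma ygen_mono (h k : nat) z : 0 <= z -> (h <= k)%N -> ygen h z <= ygen k z.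
Proof.
move=> z0; elim: k => [|k IH]; first by rewrite leqn0 => /eqP ->.
rewrite leq_eqVlt => /predU1P[-> //|/IH hk].
exact: le_trans hk (ygen_leS _ _ z0).
Qed.

(** The bound [1 - b] is preserved by the recursion [ygenS], as [(1 - b) ^+ 2 + (1 - b ^+ 2) = 2 *
    (1 - b)]. *)
Lemma ygen_le_sub (h : nat) z b : 0 <= z -> b <= 1 ->
  (forall k, 2 * z + ygen k (z ^+ 2) <= 1 - b ^+ 2) -> ygen h z <= 1 - b.
Proof.
move=> z0 b1 H; elim: h => [|h IH].
  rewrite ygen0.
  have := H 0%N; have := ygen_ge0 0 _ (sqr_ge0 z); have := sqr_ge0 (b - 1).
  nra.
have := ygenS h z; have := H h.
have : ygen h z ^+ 2 <= (1 - b) ^+ 2.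
  by rewrite lerXn2r ?nnegrE ?ygen_ge0 ?subr_ge0.
nra.
Qed.

End GeneratingPolynomial.

(** * Uniform bounds and tall trees *)

Section Counting.
Context {R : realType}.
Implicit Types z w c : R.

(** If the left side were [1 + e] with [e > 0], then [y ^+ 2 + 1 >= 2 * y] would make every further
    step of the recursion add at least [e / 2], without bound. *)
Lemma ygen_bounded_le z B : 0 <= z -> (forall h, ygen h z <= B) ->
  forall k, 2 * z + ygen k (z ^+ 2) <= 1.
Proof.
move=> z0 HB k; rewrite leNgt; apply/negP => k1.
pose e := 2 * z + ygen k (z ^+ 2) - 1.
have e0 : 0 < e by rewrite subr_gt0.
have grow j : j%:R * (e / 2) <= ygen (k + j) z.
  elim: j => [|j IH]; first by rewrite mul0r ygen_ge0.
  have := ygenS (k + j) z.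
  have : ygen k (z ^+ 2) <= ygen (k + j) (z ^+ 2).
    by apply: ygen_mono; rewrite ?sqr_ge0 ?leq_addr.
  have := sqr_ge0 (ygen (k + j) z - 1).
  have : 2 * z + ygen k (z ^+ 2) = e + 1 by rewrite /e subrK.
  rewrite addnS -(natr1 j) mulrDl mul1r; lra.
have := truncnS_gt (B / (e / 2)); rewrite ltr_pdivrMr ?divr_gt0//.
by rewrite ltNge (le_trans (grow _)).
Qed.

Lemma ygen_bounded_le1 z B : 0 <= z -> (forall h, ygen h z <= B) ->
  forall h, ygen h z <= 1.
Proof.
move=> z0 HB h; rewrite -(subr0 1); apply: ygen_le_sub => // k.
by rewrite expr0n /= subr0; exact: ygen_bounded_le HB k.
Qed.

(** Passing from [w] down to [z] lowers [2 * z + ygen k (z ^+ 2)] by at least [2 * (w - z)]; this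
    slack serves as [b ^+ 2] in [ygen_le_sub]. *)
Lemma ygen_lt_le_sub z w : 0 <= z -> z <= w -> (forall h, ygen h w <= 1) ->
  forall h, ygen h z <= 1 - Num.sqrt (2 * (w - z)).
Proof.
move=> z0 zw Hw h; have w0 : 0 <= w := le_trans z0 zw.
have H2 := ygen_bounded_le _ _ w0 Hw.
have d0 : 0 <= 2 * (w - z) by rewrite mulr_ge0// subr_ge0.
apply: ygen_le_sub => // [|k].
  rewrite -[leRHS]sqrtr1 ler_wsqrtr //.
  have := H2 0%N; have := ygen_ge0 0 _ (sqr_ge0 w); lra.
rewrite sqr_sqrtr //; have := H2 k.
have : ygen k (z ^+ 2) <= ygen k (w ^+ 2).
  by apply: ygen_le; rewrite ?sqr_ge0 // lerXn2r ?nnegrE.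
lra.
Qed.

(* The spine: a tree of height at least [h.+1] is a node with a child of height
   at least [h] and an arbitrary second child. *)
Lemma tall_le (N h : nat) z c : 0 <= z -> (forall k, ygen k z <= c) ->
  \sum_(t <- ytrees N | (h <= yheight t)%N) z ^+ ysize t <= c ^+ h.+1.
Proof.
move=> z0 Hc; have c0 : 0 <= c := le_trans (ygen_ge0 0 _ z0) (Hc 0%N).
elim: h N => [|h IH] N; first by rewrite expr1; exact: Hc.
case: N => [|N].
  by rewrite big_seq_cond big1 ?exprn_ge0// => t; rewrite mem_ytrees; lia.
rewrite big_mkcond sum_ytreesS yheight_leaf add0r exprSr.
apply: le_trans (ler_pM _ _ (IH N) (Hc N)); rewrite ?ygen_ge0//; last first.
  by apply: sumr_ge0 => t _; rewrite exprn_ge0.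
rewrite big_distrl /= [leRHS]big_mkcond; apply: ler_sum => a _.
case: ifP => ha; last first.
  by rewrite big1 // => b /yle_height ->; rewrite ltnS ha.
rewrite /ygen big_distrr big_mkcond; apply: ler_sum => b _ /=.
case: ifP => [ab|_]; last by rewrite mulr_ge0 // exprn_ge0.
by rewrite yle_height // ltnS ha ysize_node exprD.
Qed.

(** Height is less than size, so [ytrees N] contains every tree of size [n]. *)
Lemma card_Y (n N : nat) (E : set ytree) : (n <= N)%N ->
  (#|` fset_set (Y n `&` E)|)%:R =
  \sum_(t <- ytrees N | (ysize t == n) && `[< E t >]) 1 :> R.
Proof.
move=> nN.
have -> : Y n `&` E =
    [set` [seq t <- ytrees N | (ysize t == n) && `[< E t >]]].
  apply/seteqP; split => t /=; rewrite mem_filter mem_ytrees.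
    move=> [tn Et]; rewrite tn eqxx (asboolT Et) /=.
    by rewrite (leq_trans _ nN) // -tn ltnW // yheight_lt_size.
  by case/andP => /andP[/eqP tn /asboolP Et] _.
set s := [seq _ <- _ | _].
have -> : [set` s] = [set` [fset t in s]%fset].
  by apply/seteqP; split => t /=; rewrite in_fset.
rewrite set_fsetK card_fseq undup_id ?filter_uniq ?ytrees_uniq //.
by rewrite -sum1_size natr_sum big_filter.
Qed.

End Counting.

(** * Exponential growth of the number of trees *)

Definition ynum (n : nat) : nat := #|` fset_set (Y n)|.

Section Growth.
Context {R : realType}.
Implicit Types z w c : R.

Lemma ynumE (n N : nat) : (n <= N)%N ->
  (ynum n)%:R = \sum_(t <- ytrees N | ysize t == n) 1 :> R.
Proof.
move=> nN; rewrite /ynum -[Y n]setIT (card_Y n N) //.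
by apply: eq_bigl => t; rewrite asboolT ?andbT.
Qed.

Lemma ynum0 : ynum 0 = 0%N.
Proof.
rewrite /ynum; suff -> : Y 0 = set0 by rewrite fset_set0 cardfs0.
by rewrite -subset0 => t /= t0; have := yheight_lt_size t; rewrite t0.
Qed.

Lemma ynum_gt0 (n : nat) : (0 < n)%N -> (0 < ynum n)%N.
Proof.
move=> n0; have [t tn] : exists t, Y n t.
  case: n n0 => // n _; elim: n => [|n [t tn]].
    by exists yleaf; exact: ysize_leaf.
  by exists (ynode yleaf t); rewrite /Y /= ysize_node ysize_leaf tn.
rewrite /ynum cardfs_gt0; apply/fset0Pn; exists t.
by rewrite in_fset_set ?inE //; exact: finite_Y.
Qed.

(** Joining two trees under a new root is at most two-to-one on ordered pairs. *)
Lemma ynumM_le (n m : nat) :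
  (ynum n)%:R * (ynum m)%:R <= 2 * (ynum (n + m))%:R :> R.
Proof.
rewrite (ynumE (n + m) (n + m).+1) // (ynumE n (n + m)) ?leq_addr//.
rewrite (ynumE m (n + m)) ?leq_addl// [X in 2 * X]big_mkcond.
rewrite double_sum_ytreesS -addrA addrCA ler_wpDr//.
  rewrite addr_ge0 //; first by case: ifP; rewrite ?mulr1 ?mulr0.
  by apply: sumr_ge0 => a _; case: ifP.
rewrite big_distrl big_mkcond; apply: ler_sum => a _ /=.
case: ifP => an; last by apply: sumr_ge0 => b _; case: ifP.
rewrite mul1r big_mkcond; apply: ler_sum => b _ /=; rewrite ysize_node.
by case: ifP => bm; [rewrite (eqP an) (eqP bm) eqxx | case: ifP].
Qed.

Lemma sum_ysize_le (h m : nat) :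
  \sum_(t <- ytrees h | ysize t == m) 1 <= (ynum m)%:R :> R.
Proof.
rewrite (ynumE m (maxn h m)) ?leq_maxr//.
have sum1 s : \sum_(t <- s | ysize t == m) 1 =
    (size [seq t <- s | ysize t == m])%:R :> R.
  by rewrite size_filter -sum1_count natr_sum.
rewrite !sum1 ler_nat; apply: uniq_leq_size; first
  exact/filter_uniq/ytrees_uniq.
by move=> t; rewrite !mem_filter !mem_ytrees => /andP[-> /=]; lia.
Qed.

(** Grouping trees by size compares [ygen h z] with a geometric series of ratio [z / w]. *)
Lemma ygen_bounded z w : 0 <= z -> z < w ->
  (forall m, (ynum m)%:R <= 2 * w ^- m) -> exists B, forall h, ygen h z <= B.
Proof.
move=> z0 zw Hw; have w0 : 0 < w := le_lt_trans z0 zw.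
pose q := z / w.
have q0 : 0 <= q by rewrite divr_ge0 // ltW.
have q1 : q < 1 by rewrite ltr_pdivrMr ?mul1r.
exists (2 / (1 - q)) => h.
pose M := (\max_(t <- ytrees h) ysize t).+1.
have -> : ygen h z =
    \sum_(m < M) (\sum_(t <- ytrees h | ysize t == m) 1) * z ^+ m.
  under [RHS]eq_bigr do rewrite big_distrl big_mkcond /=.
  rewrite exchange_big /ygen big_seq [RHS]big_seq /=; apply: eq_bigr => t tL.
  have tM : (ysize t < M)%N by rewrite ltnS; apply: leq_bigmax_seq.
  rewrite (bigD1 (Ordinal tM)) //= eqxx mul1r big1 ?addr0 // => m mt.
  by case: eqP => // tm; case/eqP: mt; apply: val_inj.
apply: (@le_trans _ _ (\sum_(m < M) 2 * q ^+ m)).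
  apply: ler_sum => m _; apply: (@le_trans _ _ (2 * w ^- m * z ^+ m)).
    rewrite ler_wpM2r ?exprn_ge0 //.
    exact: le_trans (sum_ysize_le h m) (Hw m).
  by rewrite /q expr_div_n -mulrA (mulrC (w ^- m)).
rewrite -mulr_sumr ler_wpM2l // -[leRHS]mul1r ler_pdivlMr ?subr_gt0 //.
by rewrite mulrC -opprB mulNr -subrX1 opprB lerBlDr lerDl exprn_ge0.
Qed.

(** By [ynumM_le], [ynum n * w ^+ n] does not decrease when [n] grows by [m]. The constant [w ^+ m]
    covers [n <= m], where at least one tree exists. *)
Lemma ynum_ge w (m : nat) : 0 < w -> w <= 1 -> 2 * w ^- m < (ynum m)%:R ->
  exists2 c, 0 < c & forall n, (0 < n)%N -> c * w ^- n <= (ynum n)%:R.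
Proof.
move=> w0 w1 wm.
have wX n : 0 < w ^+ n by exact: exprn_gt0.
have m0 : (0 < m)%N.
  case: m wm => //; rewrite ynum0 expr0 invr1; lra.
exists (w ^+ m) => // n; elim/ltn_ind: n => n IH n0.
rewrite ler_pdivrMr //.
case: (leqP n m) => nm.
  apply: (@le_trans _ _ (w ^+ n)); first by rewrite ler_wiXn2l // ltW.
  by rewrite -[leLHS]mul1r ler_wpM2r ?ler1n ?ynum_gt0 // ltW.
have := IH (n - m)%N; rewrite ltn_subrL m0 n0 subn_gt0 nm => /(_ isT isT).
have := ynumM_le (n - m) m; rewrite subnK ?(ltnW nm) // => H1 H2.
rewrite ler_pdivrMr // in H2; rewrite ltr_pdivrMr // in wm.
have -> : w ^+ n = w ^+ (n - m) * w ^+ m by rewrite -exprD subnK // ltnW.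
have two0 : 0 < 2 :> R by [].
rewrite -(ler_pM2l two0).
apply: (@le_trans _ _
  ((ynum (n - m))%:R * w ^+ (n - m) * ((ynum m)%:R * w ^+ m))).
  by rewrite [leLHS]mulrC; apply: ler_pM => //; exact: ltW.
by rewrite mulrACA [leRHS]mulrA ler_wpM2r // ltW // mulr_gt0.
Qed.

End Growth.

(** * The radius of convergence and the tail estimate *)

Section Radius.
Context {R : realType}.
Implicit Types z w c : R.

(** Sizes are at least 1, so [ygen h (z ^+ 2) <= z * ygen h z], and the recursion preserves the
    bound. This keeps the radius away from 0. *)
Lemma ygen_quarter (h : nat) : ygen h (4^-1 : R) <= 2^-1.
Proof.
have q0 : 0 <= 4^-1 :> R by rewrite invr_ge0.
elim: h => [|h IH]; first by rewrite ygen0; lra.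
have := ygenS h (4^-1 : R).
have : ygen h (4^-1 ^+ 2 : R) <= 4^-1 * ygen h 4^-1.
  rewrite /ygen big_distrr; apply: ler_sum => t _ /=.
  rewrite -exprM mulnC exprM expr2 ler_wpM2r ?exprn_ge0 //.
  have t0 : (0 < ysize t)%N by apply: leq_ltn_trans (yheight_lt_size t).
  by rewrite ler_iXnr // invf_le1 // ler1n.
have := ygen_ge0 h _ q0.
move: (ygen h 4^-1) IH => W; nra.
Qed.

(* [z] and [w] bracket the radius of convergence of the generating function. *)
Lemma near_radius (e : R) : 0 < e -> e <= 8^-1 ->
  exists z w, [/\ 8^-1 <= z, z <= w, w - z <= 2 * e,
    forall h, ygen h z <= 1 &
    exists2 c, 0 < c & forall n, (0 < n)%N -> c * w ^- n <= (ynum n)%:R].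
Proof.
move=> e0 e8.
pose S := [set z : R | 0 <= z /\ forall h, ygen h z <= 1].
have Sq : S 4^-1.
  split=> [|h]; first by rewrite invr_ge0.
  by apply: le_trans (ygen_quarter h) _; lra.
have Sub : ubound S 2^-1.
  move=> z [z0 Hz]; have := ygen_bounded_le _ _ z0 Hz 0%N.
  have := ygen_ge0 0 _ (sqr_ge0 z); lra.
have supS : has_sup S by split; [exists 4^-1 | exists 2^-1].
have rho_ge : 4^-1 <= sup S by apply: ub_le_sup => //; exists 2^-1.
have rho_le : sup S <= 2^-1 by apply: ge_sup => //; exists 4^-1.
have [z [z0 Hz] zr] := sup_adherent e0 supS.
have zle : z <= sup S by apply: ub_le_sup => //; exists 2^-1.
exists z, (sup S + e); split => //; try lra.
(* Otherwise the polynomials would be bounded at [sup S + e / 2], hence bounded by 1 there,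
   contradicting the supremum. *)
have [m mP] : exists m, 2 * (sup S + e) ^- m < (ynum m)%:R.
  apply: contrapT => /forallNP H.
  have w0 : 0 <= sup S + e / 2 by lra.
  have wlt : sup S + e / 2 < sup S + e by lra.
  have [|B HB] := ygen_bounded _ _ w0 wlt.
    by move=> m; rewrite leNgt; apply/negP/H.
  have : sup S + e / 2 <= sup S.
    apply: ub_le_sup; first by exists 2^-1.
    by split => // h; exact: ygen_bounded_le1 HB h.
  lra.
by apply: (ynum_ge _ m) => //; lra.
Qed.

(* The generating function at [x = z / (1 + xi ^ 2 / 32)] is at most
   [1 - xi / 16], and a tree of height at least [xi * n] contributes more than
   [xi * n] factors of this kind. *)
Lemma tall_card_le (n : nat) z w xi e : 8^-1 <= z -> z <= w ->
  w - z <= 2 * e -> 1024 * e <= xi ^+ 2 -> (forall h, ygen h z <= 1) ->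
  0 < xi -> xi <= 1 ->
  (#|` fset_set (Y n `&` [set t | xi * n%:R <= (yheight t)%:R])|)%:R * w ^+ n
    <= expR (- (n%:R * (xi ^+ 2 / 64))).
Proof.
move=> z8 zw wz ex Hz xi0 xi1.
have xi2 : xi ^+ 2 <= 1 by rewrite expr_le1 // ltW.
have xi2p : 0 < xi ^+ 2 by rewrite exprn_gt0.
pose s := xi ^+ 2 / 32.
have s0 : 0 < s by rewrite /s; lra.
have s1 : s <= 1 by rewrite /s; lra.
have z0 : 0 < z by lra.
pose x := z / (1 + s).
have xs : x * (1 + s) = z by rewrite /x divfK //; lra.
have x0 : 0 < x by rewrite divr_gt0 //; lra.
have xz : x <= z by nra.
pose b := Num.sqrt (2 * (z - x)).
have Hx : forall h, ygen h x <= 1 - b := ygen_lt_le_sub _ _ (ltW x0) xz Hz.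
have b1 : 0 <= 1 - b by apply: le_trans (Hx 0%N); rewrite ygen_ge0 // ltW.
(* Here [x >= 1 / 16], so [2 * (z - x) = 2 * x * s >= xi ^+ 2 / 256]. *)
have bxi : xi / 16 <= b.
  have xi16 : 0 <= xi / 16 by lra.
  rewrite /b -(ger0_norm xi16) -sqrtr_sqr ler_wsqrtr // expr_div_n.
  have -> : z - x = x * s by rewrite -xs; ring.
  have : 16^-1 <= x by nra.
  rewrite /s; nra.
pose h := Num.truncn (xi * n%:R).
have hgt : xi * n%:R < h.+1%:R by exact: truncnS_gt.
have hle : h%:R <= xi * n%:R by rewrite truncn_le mulr_ge0 // ltW.
have A : (#|` fset_set (Y n `&` [set t | xi * n%:R <= (yheight t)%:R])|)%:R
    * x ^+ n <= (1 - b) ^+ h.+1.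
  apply: le_trans (tall_le n h _ _ (ltW x0) Hx).
  rewrite (card_Y n n) // big_distrl /= big_mkcond [leRHS]big_mkcond.
  apply: ler_sum => t _; case: ifP => [/andP[/eqP tn /asboolP /= ht]|_].
    by rewrite -(ler_nat R) (le_trans hle ht) mul1r tn.
  by case: ifP => // _; rewrite exprn_ge0 // ltW.
have -> : w ^+ n = x ^+ n * (w / x) ^+ n.
  by rewrite -exprMn mulrCA divff ?mulr1 // gt_eqF.
rewrite mulrA.
(* The second factor bounds [(w / x) ^+ n], as [w / z <= 1 + 16 * e]. With [16 * e <= xi ^+ 2 / 64]
   the coefficients of [xi ^+ 2] are [- 4 / 64 + 1 / 64 + 2 / 64 = - 1 / 64]. *)
apply: (@le_trans _ _ (expR (- (xi / 16) * (xi * n%:R)) *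
                       expR ((16 * e + s) * n%:R))); last first.
  rewrite -expRD ler_expR /s.
  have : 0 <= n%:R :> R by [].
  move: (n%:R : R) => N; nra.
apply: ler_pM.
- by rewrite mulr_ge0 // exprn_ge0 // ltW.
- by rewrite exprn_ge0 // divr_ge0 ?ltW // (lt_le_trans z0).
- apply: le_trans A _.
  apply: (@le_trans _ _ (expR (- b) ^+ h.+1)).
    rewrite lerXn2r ?nnegrE ?expR_ge0 //.
    exact: expR_ge1Dx.
  rewrite -expRM_natr ler_expR.
  have : 0 <= xi * n%:R by rewrite mulr_ge0 // ltW.
  nra.
rewrite expRM_natr lerXn2r ?nnegrE ?expR_ge0 //.
  by rewrite divr_ge0 ?ltW // (lt_le_trans z0).
rewrite expRD (_ : w / x = w / z * (1 + s)); last first.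
  by rewrite -xs invfM mulrA divfK //; lra.
rewrite ler_pM //; [| | |exact: expR_ge1Dx].
- by rewrite divr_ge0; lra.
- lra.
apply: le_trans (expR_ge1Dx _); rewrite ler_pdivrMr //; nra.
Qed.

End Radius.

(** * The large deviation bound *)

Theorem theorem4 (R : realType) :
  exists I : R -> R,
    [/\ {within `]0, 1], continuous I},
        {in `]0, 1] &, {homo I : x y / x < y}},
        (forall xi : R, 0 < xi <= 1 -> 0 < I xi) &
        forall delta : R, 0 < delta ->
          exists K : R, forall (n : nat) (xi : R),
            (0 < n)%N -> delta < xi < 1 - delta ->
            prob_height_ge n (xi * n%:R) <=
              K * n%:R `^ (3 / 2) * expR (- (n%:R * I xi))].
Proof.
exists (fun xi => xi ^+ 2 / 64); split.
- apply: continuous_subspaceT => x.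
  by apply: cvgMl; exact: exprn_continuous.
- move=> x y; rewrite !in_itv /= => /andP[x0 _] /andP[y0 _] xy.
  by rewrite ltr_pM2r // ltrXn2r // ltW.
- by move=> xi /andP[xi0 _]; rewrite divr_gt0 // exprn_gt0.
move=> delta d0; case: (leP 1 delta) => d1.
  by exists 0 => n xi _ /andP[? ?]; exfalso; lra.
have d2 : 0 < delta ^+ 2 by rewrite exprn_gt0.
(* Since [e] depends on [delta] only, so do [z], [w] and [c], which makes [K = c^-1] uniform in [xi]
   and [n]. *)
have [e [e0 e8 de]] : exists e, [/\ 0 < e, e <= 8^-1 & 1024 * e = delta ^+ 2].
  have d2_le1 : delta ^+ 2 <= 1 by rewrite expr_le1 // ltW.
  by exists (delta ^+ 2 / 1024); split; lra.
have [z [w [z8 zw wz Hz [c c0 Hc]]]] := near_radius _ e0 e8.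
exists c^-1 => n xi n0 /andP[dxi xid].
have w0 : 0 < w by lra.
have y0 : 0 < (ynum n)%:R :> R by rewrite ltr0n ynum_gt0.
have xi0 : 0 < xi by lra.
have xi1 : xi <= 1 by lra.
have ex : 1024 * e <= xi ^+ 2 by rewrite de lerXn2r ?nnegrE; lra.
have := tall_card_le n _ _ _ _ z8 zw wz ex Hz xi0 xi1.
rewrite /prob_height_ge /uniform_prob -/(ynum n) ler_pdivrMr //.
rewrite -ler_pdivlMr ?exprn_gt0 // => /le_trans; apply.
rewrite [leRHS]mulrAC.
set E := expR _.
apply: (@le_trans _ _ (c^-1 * (c * w ^- n) * E)).
  by rewrite mulKf ?gt_eqF // mulrC.
rewrite ler_wpM2r ?expR_ge0 //.
apply: (@le_trans _ _ (c^-1 * (ynum n)%:R)).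
  by rewrite ler_wpM2l ?Hc // invr_ge0 ltW.
(* The polynomial factor is at least 1 because [n] is positive. *)
rewrite mulrAC ler_peMr //; first by rewrite mulr_ge0 ?invr_ge0 // ltW.
rewrite -[leLHS](powRr0 n%:R) ler_powR ?ler1n //; lra.
Qed.
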